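(* (Subject reduction.) If $\Upsilon;\Gamma\vdash t:A$ is derivable and $t\longrightarrow u$, then $\Upsilon;\Gamma\vdash u:A$ is derivable.
   Context: The $\mathcal L_!^{\mathcal S}$-calculus. Let $\mathcal S$ be a commutative semiring, whose elements are called scalars. Propositions are generated by $A ::= \mathfrak 1\mid A\multimap A\mid A\otimes A\mid\top\mid\mathfrak 0\mid A\mathbin{\&}A\mid A\oplus A\mid {!}A$. Proof-terms, taken modulo $\alpha$-equivalence, are generated by (with $a\in\mathcal S$) $t ::= x\mid t\boxplus u\mid a\bullet t\mid a.\star\mid\delta_{\mathfrak 1}(t,u)\mid\lambda x^A.t\mid t\,u\mid t\otimes u\mid\delta_\otimes(t,x^Ay^B.u)\mid\langle\rangle\mid\delta_{\mathfrak 0}(t)\mid\langle t,u\rangle\mid\delta_{\&}^1(t,x^A.u)\mid\delta_{\&}^2(t,x^B.u)\mid\mathit{inl}(t)\mid\mathit{inr}(t)\mid\delta_\oplus(t,x^A.u,y^B.v)\mid {!}t\mid\delta_!(t,x^A.u)$. Variables before a dot are bound in the term after it; $(u/x)t$ is capture-avoiding substitution of $u$ for $x$ in $t$. Judgements $\Upsilon;\Gamma\vdash t:A$ have an intuitionistic context $\Upsilon$ and a linear context $\Gamma$ (finite sets of typed variables; $\Gamma,\Delta$ is disjoint union). Typing rules: - $\Upsilon;x^A\vdash x:A$; and $\Upsilon,x^A;\varnothing\vdash x:A$. - If $\Upsilon;\Gamma\vdash t:A$ and $\Upsilon;\Gamma\vdash u:A$ then $\Upsilon;\Gamma\vdash t\boxplus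 u:A$. If $\Upsilon;\Gamma\vdash t:A$ then $\Upsilon;\Gamma\vdash a\bullet t:A$. - $\Upsilon;\varnothing\vdash a.\star:\mathfrak 1$. If $\Upsilon;\Gamma\vdash t:\mathfrak 1$ and $\Upsilon;\Delta\vdash u:A$ then $\Upsilon;\Gamma,\Delta\vdash\delta_{\mathfrak 1}(t,u):A$. - If $\Upsilon;\Gamma,x^A\vdash t:B$ then $\Upsilon;\Gamma\vdash\lambda x^A.t:A\multimap B$. If $\Upsilon;\Gamma\vdash t:A\multimap B$ and $\Upsilon;\Delta\vdash u:A$ then $\Upsilon;\Gamma,\Delta\vdash t\,u:B$. - If $\Upsilon;\Gamma\vdash t:A$ and $\Upsilon;\Delta\vdash u:B$ then $\Upsilon;\Gamma,\Delta\vdash t\otimes u:A\otimes B$. If $\Upsilon;\Gamma\vdash t:A\otimes B$ and $\Upsilon;\Delta,x^A,y^B\vdash u:C$ then $\Upsilon;\Gamma,\Delta\vdash\delta_\otimes(t,x^Ay^B.u):C$. - $\Upsilon;\Gamma\vdash\langle\rangle:\top$. If $\Upsilon;\Gamma\vdash t:\mathfrak 0$ then $\Upsilon;\Gamma,\Delta\vdash\delta_{\mathfrak 0}(t):C$. - If $\Upsilon;\Gamma\vdash t:A$ and $\Upsilon;\Gamma\vdash u:B$ then $\Upsilon;\Gamma\vdash\langle t,u\rangle:A\mathbin{\&}B$. If $\Upsilon;\Gamma\vdash t:A\mathbin{\&}B$ and $\Upsilon;\Delta,x^A\vdash u:C$ (resp. $\Upsilon;\Delta,x^B\vdash u:C$)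 then $\Upsilon;\Gamma,\Delta\vdash\delta_{\&}^1(t,x^A.u):C$ (resp. $\delta_{\&}^2(t,x^B.u):C$). - If $\Upsilon;\Gamma\vdash t:A$ (resp. $t:B$) then $\Upsilon;\Gamma\vdash\mathit{inl}(t):A\oplus B$ (resp. $\mathit{inr}(t):A\oplus B$). If $\Upsilon;\Gamma\vdash t:A\oplus B$, $\Upsilon;\Delta,x^A\vdash u:C$ and $\Upsilon;\Delta,y^B\vdash v:C$ then $\Upsilon;\Gamma,\Delta\vdash\delta_\oplus(t,x^A.u,y^B.v):C$. - If $\Upsilon;\varnothing\vdash t:A$ then $\Upsilon;\varnothing\vdash {!}t:{!}A$. If $\Upsilon;\Gamma\vdash t:{!}A$ and $\Upsilon,x^A;\Delta\vdash u:B$ then $\Upsilon;\Gamma,\Delta\vdash\delta_!(t,x^A.u):B$. Reduction $\longrightarrow$ is the closure under arbitrary term contexts of: $\delta_{\mathfrak 1}(a.\star,t)\to a\bullet t$; $(\lambda x^A.t)\,u\to(u/x)t$; $\delta_\otimes(u\otimes v,x^Ay^B.w)\to(u/x,v/y)w$; $\delta_{\&}^i(\langle t_1,t_2\rangle,x^A.v)\to(t_i/x)v$ ($i=1,2$); $\delta_\oplus(\mathit{inl}(t),x^A.v,y^B.w)\to(t/x)v$; $\delta_\oplus(\mathit{inr}(u),x^A.v,y^B.w)\to(u/y)w$; $\delta_!({!}t,x^A.u)\to(t/x)u$; $a.\star\boxplus b.\star\to(a+b).\star$; $(\lambda x^A.t)\boxplus(\lambda x^A.u)\to\lambda x^A.(t\boxplus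 u)$; $\delta_\otimes(t\boxplus u,x^Ay^B.v)\to\delta_\otimes(t,x^Ay^B.v)\boxplus\delta_\otimes(u,x^Ay^B.v)$; $\langle\rangle\boxplus\langle\rangle\to\langle\rangle$; $\langle t,u\rangle\boxplus\langle v,w\rangle\to\langle t\boxplus v,u\boxplus w\rangle$; $\delta_\oplus(t\boxplus u,x^A.v,y^B.w)\to\delta_\oplus(t,x^A.v,y^B.w)\boxplus\delta_\oplus(u,x^A.v,y^B.w)$; $\delta_!(t\boxplus u,x^A.v)\to\delta_!(t,x^A.v)\boxplus\delta_!(u,x^A.v)$; $a\bullet b.\star\to(a\times b).\star$; $a\bullet\lambda x^A.t\to\lambda x^A.a\bullet t$; $\delta_\otimes(a\bullet t,x^Ay^B.v)\to a\bullet\delta_\otimes(t,x^Ay^B.v)$; $a\bullet\langle\rangle\to\langle\rangle$; $a\bullet\langle t,u\rangle\to\langle a\bullet t,a\bullet u\rangle$; $\delta_\oplus(a\bullet t,x^A.v,y^B.w)\to a\bullet\delta_\oplus(t,x^A.v,y^B.w)$; $\delta_!(a\bullet t,x^A.v)\to a\bullet\delta_!(t,x^A.v)$. *)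

(* Defs.v *)
From mathcomp Require Import all_boot all_algebra.
From mathcomp Require Import finmap.

Set Implicit Arguments.
Unset Strict Implicit.
Unset Printing Implicit Defensive.

Inductive formula : Type :=
| One
| Lolli of formula & formula
| Tensor of formula & formula
| Top
| Zero
| With of formula & formula
| Plus of formula & formula
| Bang of formula.

(** Proof-terms modulo alpha-equivalence, in de Bruijn representation: a
    variable is a natural number, index 0 is the variable bound by the closest
    enclosing binder, and a free variable [n] is seen as [n + k] under [k]
    binders. In [DTensor t A B u], which stands for delta_tensor(t, x^A y^B.u),
    [x] is index 1 and [y] is index 0 in [u]. *)
Inductive term (S : Type) : Type :=
| Var of nat
| Sum of term S & term S
| Scal of S & term S
| Star of S
| DOne of term S & term S
| Lam of formula & term S
| App of term S & term S
| TensorI of term S & term S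
| DTensor of term S & formula & formula & term S
| Unit
| DZero of term S
| Pair of term S & term S
| DWith1 of term S & formula & term S
| DWith2 of term S & formula & term S
| Inl of term S
| Inr of term S
| DPlus of term S & formula & term S & formula & term S
| BangI of term S
| DBang of term S & formula & term S.

Arguments Var {S} _.
Arguments Star {S} _.
Arguments Unit {S}.

Section Substitution.
Variable S : Type.
Implicit Types (t u v : term S).

Definition upren (r : nat -> nat) (n : nat) : nat :=
  if n is m.+1 then (r m).+1 else 0.

Fixpoint rename (r : nat -> nat) t : term S :=
  match t with
  | Var n => Var (r n)
  | Sum t u => Sum (rename r t) (rename r u)
  | Scal a t => Scal a (rename r t)
  | Star a => Star a
  | DOne t u => DOne (rename r t) (rename r u)
  | Lam A t => Lam A (rename (upren r) t)
  | App t u => App (rename r t) (rename r u)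
  | TensorI t u => TensorI (rename r t) (rename r u)
  | DTensor t A B u => DTensor (rename r t) A B (rename (upren (upren r)) u)
  | Unit => Unit
  | DZero t => DZero (rename r t)
  | Pair t u => Pair (rename r t) (rename r u)
  | DWith1 t A u => DWith1 (rename r t) A (rename (upren r) u)
  | DWith2 t A u => DWith2 (rename r t) A (rename (upren r) u)
  | Inl t => Inl (rename r t)
  | Inr t => Inr (rename r t)
  | DPlus t A u B v =>
      DPlus (rename r t) A (rename (upren r) u) B (rename (upren r) v)
  | BangI t => BangI (rename r t)
  | DBang t A u => DBang (rename r t) A (rename (upren r) u)
  end.

Definition up (s : nat -> term S) (n : nat) : term S :=
  if n is m.+1 then rename succn (s m) else Var 0.

Fixpoint subst (s : nat -> term S) t : term S :=
  match t with
  | Var n => s n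
  | Sum t u => Sum (subst s t) (subst s u)
  | Scal a t => Scal a (subst s t)
  | Star a => Star a
  | DOne t u => DOne (subst s t) (subst s u)
  | Lam A t => Lam A (subst (up s) t)
  | App t u => App (subst s t) (subst s u)
  | TensorI t u => TensorI (subst s t) (subst s u)
  | DTensor t A B u => DTensor (subst s t) A B (subst (up (up s)) u)
  | Unit => Unit
  | DZero t => DZero (subst s t)
  | Pair t u => Pair (subst s t) (subst s u)
  | DWith1 t A u => DWith1 (subst s t) A (subst (up s) u)
  | DWith2 t A u => DWith2 (subst s t) A (subst (up s) u)
  | Inl t => Inl (subst s t)
  | Inr t => Inr (subst s t)
  | DPlus t A u B v => DPlus (subst s t) A (subst (up s) u) B (subst (up s) v)
  | BangI t => BangI (subst s t)
  | DBang t A u => DBang (subst s t) A (subst (up s) u)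
  end.

(** [(u/x)t], where [x] is index 0 in [t]; the binder of [x] disappears, hence
    the other variables are lowered by one. *)
Definition subst1 u t : term S :=
  subst (fun n => if n is m.+1 then Var m else u) t.

(** The simultaneous substitution [(u/x, v/y)t], where [x] is index 1 and [y]
    is index 0 in [t]. *)
Definition subst2 u v t : term S :=
  subst (fun n => match n with 0 => v | 1 => u | m.+2 => Var m end) t.

End Substitution.

Local Open Scope fset_scope.
Local Open Scope fmap_scope.

Definition context : Type := {fmap nat -> formula}.

(** [shift G] is the context [G] as seen from under one more binder. The
    default value of [odflt] is never used. *)
Definition shift (G : context) : context :=
  [fmap k : [fset i.+1 | i in domf G] => odflt One G.[? (val k).-1]].

Lemma fnd_shift (G : context) (n : nat) :
  (shift G).[? n] = if n is m.+1 then G.[? m] else None.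
Proof.
case: fndP => [kf|]; last first.
  case: n => [//|m] /imfsetP nm; apply/esym/not_fnd/negP => mG.
  by apply: nm; exists m.
rewrite ffunE /=; case/imfsetP: (kf) => i /= iG ->.
by rewrite (in_fnd iG).
Qed.

(** [G, x^A], where the fresh variable [x] is index 0. *)
Definition ext (G : context) (A : formula) : context := (shift G).[0 <- A].

Definition disj (G D : context) : bool := [disjoint domf G & domf D]%fset.

(** [typing Y G t A] is the judgement [Y; G |- t : A]. The variables declared in
    [Y] and in [G] must be pairwise distinct: the side conditions on [disj]
    ensure that [disj Y G] holds for every derivable judgement, and that
    [G + D] is only formed when it is a disjoint union. *)
Inductive typing (S : Type) :
    context -> context -> term S -> formula -> Prop :=
| ty_lvar (Y : context) (n : nat) (A : formula) :
    n \notin domf Y ->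
    typing Y [fmap].[n <- A] (Var n) A
| ty_ivar (Y : context) (n : nat) (A : formula) :
    Y.[? n] = Some A ->
    typing Y [fmap] (Var n) A
| ty_sum (Y G : context) (t u : term S) (A : formula) :
    typing Y G t A -> typing Y G u A ->
    typing Y G (Sum t u) A
| ty_scal (Y G : context) (a : S) (t : term S) (A : formula) :
    typing Y G t A ->
    typing Y G (Scal a t) A
| ty_star (Y : context) (a : S) :
    typing Y [fmap] (Star a) One
| ty_done (Y G D : context) (t u : term S) (A : formula) :
    disj G D ->
    typing Y G t One -> typing Y D u A ->
    typing Y (G + D) (DOne t u) A
| ty_lam (Y G : context) (t : term S) (A B : formula) :
    typing (shift Y) (ext G A) t B ->
    typing Y G (Lam A t) (Lolli A B)
| ty_app (Y G D : context) (t u : term S) (A B : formula) :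
    disj G D ->
    typing Y G t (Lolli A B) -> typing Y D u A ->
    typing Y (G + D) (App t u) B
| ty_tensor (Y G D : context) (t u : term S) (A B : formula) :
    disj G D ->
    typing Y G t A -> typing Y D u B ->
    typing Y (G + D) (TensorI t u) (Tensor A B)
| ty_dtensor (Y G D : context) (t u : term S) (A B C : formula) :
    disj G D ->
    typing Y G t (Tensor A B) ->
    typing (shift (shift Y)) (ext (ext D A) B) u C ->
    typing Y (G + D) (DTensor t A B u) C
| ty_unit (Y G : context) :
    disj Y G ->
    typing Y G Unit Top
| ty_dzero (Y G D : context) (t : term S) (C : formula) :
    disj G D -> disj Y D ->
    typing Y G t Zero ->
    typing Y (G + D) (DZero t) C
| ty_pair (Y G : context) (t u : term S) (A B : formula) :
    typing Y G t A -> typing Y G u B ->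
    typing Y G (Pair t u) (With A B)
| ty_dwith1 (Y G D : context) (t u : term S) (A B C : formula) :
    disj G D ->
    typing Y G t (With A B) -> typing (shift Y) (ext D A) u C ->
    typing Y (G + D) (DWith1 t A u) C
| ty_dwith2 (Y G D : context) (t u : term S) (A B C : formula) :
    disj G D ->
    typing Y G t (With A B) -> typing (shift Y) (ext D B) u C ->
    typing Y (G + D) (DWith2 t B u) C
| ty_inl (Y G : context) (t : term S) (A B : formula) :
    typing Y G t A ->
    typing Y G (Inl t) (Plus A B)
| ty_inr (Y G : context) (t : term S) (A B : formula) :
    typing Y G t B ->
    typing Y G (Inr t) (Plus A B)
| ty_dplus (Y G D : context) (t u v : term S) (A B C : formula) :
    disj G D ->
    typing Y G t (Plus A B) ->
    typing (shift Y) (ext D A) u C -> typing (shift Y) (ext D B) v C ->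
    typing Y (G + D) (DPlus t A u B v) C
| ty_bang (Y : context) (t : term S) (A : formula) :
    typing Y [fmap] t A ->
    typing Y [fmap] (BangI t) (Bang A)
| ty_dbang (Y G D : context) (t u : term S) (A B : formula) :
    disj G D ->
    typing Y G t (Bang A) -> typing (ext Y A) (shift D) u B ->
    typing Y (G + D) (DBang t A u) B.

Inductive red (S : comPzSemiRingType) : term S -> term S -> Prop :=
| red_one (a : S) (t : term S) :
    red (DOne (Star a) t) (Scal a t)
| red_beta (A : formula) (t u : term S) :
    red (App (Lam A t) u) (subst1 u t)
| red_tensor (A B : formula) (u v w : term S) :
    red (DTensor (TensorI u v) A B w) (subst2 u v w)
| red_with1 (A : formula) (t1 t2 v : term S) :
    red (DWith1 (Pair t1 t2) A v) (subst1 t1 v)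
| red_with2 (A : formula) (t1 t2 v : term S) :
    red (DWith2 (Pair t1 t2) A v) (subst1 t2 v)
| red_inl (A B : formula) (t v w : term S) :
    red (DPlus (Inl t) A v B w) (subst1 t v)
| red_inr (A B : formula) (u v w : term S) :
    red (DPlus (Inr u) A v B w) (subst1 u w)
| red_bang (A : formula) (t u : term S) :
    red (DBang (BangI t) A u) (subst1 t u)
| red_sum_star (a b : S) :
    red (Sum (Star a) (Star b)) (Star (a + b)%R)
| red_sum_lam (A : formula) (t u : term S) :
    red (Sum (Lam A t) (Lam A u)) (Lam A (Sum t u))
| red_sum_dtensor (A B : formula) (t u v : term S) :
    red (DTensor (Sum t u) A B v) (Sum (DTensor t A B v) (DTensor u A B v))
| red_sum_unit :
    red (Sum Unit Unit) Unit
| red_sum_pair (t u v w : term S) :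
    red (Sum (Pair t u) (Pair v w)) (Pair (Sum t v) (Sum u w))
| red_sum_dplus (A B : formula) (t u v w : term S) :
    red (DPlus (Sum t u) A v B w) (Sum (DPlus t A v B w) (DPlus u A v B w))
| red_sum_dbang (A : formula) (t u v : term S) :
    red (DBang (Sum t u) A v) (Sum (DBang t A v) (DBang u A v))
| red_scal_star (a b : S) :
    red (Scal a (Star b)) (Star (a * b)%R)
| red_scal_lam (a : S) (A : formula) (t : term S) :
    red (Scal a (Lam A t)) (Lam A (Scal a t))
| red_scal_dtensor (a : S) (A B : formula) (t v : term S) :
    red (DTensor (Scal a t) A B v) (Scal a (DTensor t A B v))
| red_scal_unit (a : S) :
    red (Scal a Unit) Unit
| red_scal_pair (a : S) (t u : term S) :
    red (Scal a (Pair t u)) (Pair (Scal a t) (Scal a u))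
| red_scal_dplus (a : S) (A B : formula) (t v w : term S) :
    red (DPlus (Scal a t) A v B w) (Scal a (DPlus t A v B w))
| red_scal_dbang (a : S) (A : formula) (t v : term S) :
    red (DBang (Scal a t) A v) (Scal a (DBang t A v))
| ctx_sum1 (t t' u : term S) : red t t' -> red (Sum t u) (Sum t' u)
| ctx_sum2 (t u u' : term S) : red u u' -> red (Sum t u) (Sum t u')
| ctx_scal (a : S) (t t' : term S) : red t t' -> red (Scal a t) (Scal a t')
| ctx_done1 (t t' u : term S) : red t t' -> red (DOne t u) (DOne t' u)
| ctx_done2 (t u u' : term S) : red u u' -> red (DOne t u) (DOne t u')
| ctx_lam (A : formula) (t t' : term S) : red t t' -> red (Lam A t) (Lam A t')
| ctx_app1 (t t' u : term S) : red t t' -> red (App t u) (App t' u)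
| ctx_app2 (t u u' : term S) : red u u' -> red (App t u) (App t u')
| ctx_tensor1 (t t' u : term S) : red t t' -> red (TensorI t u) (TensorI t' u)
| ctx_tensor2 (t u u' : term S) : red u u' -> red (TensorI t u) (TensorI t u')
| ctx_dtensor1 (A B : formula) (t t' u : term S) :
    red t t' -> red (DTensor t A B u) (DTensor t' A B u)
| ctx_dtensor2 (A B : formula) (t u u' : term S) :
    red u u' -> red (DTensor t A B u) (DTensor t A B u')
| ctx_dzero (t t' : term S) : red t t' -> red (DZero t) (DZero t')
| ctx_pair1 (t t' u : term S) : red t t' -> red (Pair t u) (Pair t' u)
| ctx_pair2 (t u u' : term S) : red u u' -> red (Pair t u) (Pair t u')
| ctx_dwith1_1 (A : formula) (t t' u : term S) :
    red t t' -> red (DWith1 t A u) (DWith1 t' A u)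
| ctx_dwith1_2 (A : formula) (t u u' : term S) :
    red u u' -> red (DWith1 t A u) (DWith1 t A u')
| ctx_dwith2_1 (A : formula) (t t' u : term S) :
    red t t' -> red (DWith2 t A u) (DWith2 t' A u)
| ctx_dwith2_2 (A : formula) (t u u' : term S) :
    red u u' -> red (DWith2 t A u) (DWith2 t A u')
| ctx_inl (t t' : term S) : red t t' -> red (Inl t) (Inl t')
| ctx_inr (t t' : term S) : red t t' -> red (Inr t) (Inr t')
| ctx_dplus1 (A B : formula) (t t' v w : term S) :
    red t t' -> red (DPlus t A v B w) (DPlus t' A v B w)
| ctx_dplus2 (A B : formula) (t v v' w : term S) :
    red v v' -> red (DPlus t A v B w) (DPlus t A v' B w)
| ctx_dplus3 (A B : formula) (t v w w' : term S) :
    red w w' -> red (DPlus t A v B w) (DPlus t A v B w')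
| ctx_bang (t t' : term S) : red t t' -> red (BangI t) (BangI t')
| ctx_dbang1 (A : formula) (t t' u : term S) :
    red t t' -> red (DBang t A u) (DBang t' A u)
| ctx_dbang2 (A : formula) (t u u' : term S) :
    red u u' -> red (DBang t A u) (DBang t A u').

(* Main.v *)
Require Import Defs.
From mathcomp Require Import all_boot all_algebra.
From mathcomp Require Import finmap.

(** Substitutions are typed by an ownership map [o]: every variable [k] of the
    target linear context belongs to exactly one source linear variable [o k],
    and the image of [x] is typed in the part of the target context owned by
    [x]. Since ownership is a function, splitting the source context splits the
    target context, which makes the multiplicative rules immediate. Renamings
    are substitutions by variables, so one traversal of the typing derivation
    yields weakening first and then, using weakening to cross binders, the
    substitution lemma. *)

Set Implicit Arguments.
Unset Strict Implicit.
Unset Printing Implicit Defensive.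

Local Open Scope fset_scope.
Local Open Scope fmap_scope.

Implicit Types (G D Y : context) (A B C : formula) (P Q : pred nat).

(** * Contexts *)

Lemma fnd_catE G D k :
  (G + D).[? k] = if D.[? k] is Some A then Some A else G.[? k].
Proof. by rewrite fnd_cat; case: fndP. Qed.

Lemma fnd_ext G A n :
  (ext G A).[? n] = if n is m.+1 then G.[? m] else Some A.
Proof. by rewrite fnd_set fnd_shift; case: n. Qed.

Lemma mem_domf G k : (k \in domf G) = G.[? k] :> bool.
Proof. by rewrite fndSome. Qed.

Lemma disjP G D : reflect (forall k, G.[? k] -> D.[? k] -> False) (disj G D).
Proof.
apply: (iffP (@fdisjointP _ (domf G) (domf D))) => dGD k => [Gk Dk|].
  by have := dGD k; rewrite !mem_domf Dk => /(_ Gk).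
by rewrite !mem_domf => Gk; apply/negP => /(dGD k Gk).
Qed.

Lemma disj_shift G D : disj (shift G) (shift D) = disj G D.
Proof.
apply/disjP/disjP => dGD k; last first.
  by rewrite !fnd_shift; case: k => // m; apply: dGD.
by have := dGD k.+1; rewrite !fnd_shift.
Qed.

Lemma disj_shift_ext G D A : disj (shift G) (ext D A) = disj G D.
Proof.
apply/disjP/disjP => dGD k; last first.
  by rewrite fnd_shift fnd_ext; case: k => // m; apply: dGD.
by have := dGD k.+1; rewrite fnd_shift fnd_ext.
Qed.

Lemma disj_ext_shift G D A : disj (ext G A) (shift D) = disj G D.
Proof. by rewrite /disj fdisjoint_sym [RHS]fdisjoint_sym; apply: disj_shift_ext. Qed.

Lemma disj0 G : disj G [fmap].
Proof. by apply/disjP => k _; rewrite fnd_fmap0. Qed.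

Lemma disj_catr Y G D : disj Y G -> disj Y D -> disj Y (G + D).
Proof.
move=> /disjP dG /disjP dD; apply/disjP => k Yk; rewrite fnd_catE.
by case Dk: D.[? k] => [A|] => [_|]; [apply: (dD k); rewrite ?Dk | apply: dG].
Qed.

Lemma disj_catrP Y G D : disj Y (G + D) -> disj Y G /\ disj Y D.
Proof.
move=> /disjP dGD; split; apply/disjP => k Yk Zk; apply: (dGD k Yk);
  rewrite fnd_catE; by case: D.[? k] Zk.
Qed.

(** Rules that split the linear context reduce to [disj_catr]; binders are crossed because shifting
    reflects disjointness. This invariant supplies the disjointness conditions of the typed
    substitutions built below. *)
Lemma typing_disj S Y G (t : term S) A : typing Y G t A -> disj Y G.
Proof.
elim=> {Y G t A}.
- move=> Y n A nY; apply/disjP => k; rewrite fnd_set -mem_domf fnd_fmap0.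
  by case: eqP => // ->; rewrite (negPf nY).
- by move=> Y n A _; apply: disj0.
- by [].
- by [].
- by move=> Y a; apply: disj0.
- by move=> Y G D t u A _ _ dG _; apply: disj_catr.
- by move=> Y G t A B _; rewrite disj_shift_ext.
- by move=> Y G D t u A B _ _ dG _; apply: disj_catr.
- by move=> Y G D t u A B _ _ dG _; apply: disj_catr.
- by move=> Y G D t u A B C _ _ dG _; rewrite !disj_shift_ext => /(disj_catr dG).
- by [].
- by move=> Y G D t C _ dD _ dG; apply: disj_catr.
- by [].
- by move=> Y G D t u A B C _ _ dG _; rewrite disj_shift_ext => /(disj_catr dG).
- by move=> Y G D t u A B C _ _ dG _; rewrite disj_shift_ext => /(disj_catr dG).
- by [].
- by [].
- move=> Y G D t u v A B C _ _ dG _; rewrite disj_shift_ext.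
  by move=> /(disj_catr dG).
- by [].
- by move=> Y G D t u A B _ _ dG _; rewrite disj_ext_shift => /(disj_catr dG).
Qed.

(** * Typed substitutions *)

Definition judgement (S : Type) := context -> context -> term S -> formula -> Prop.

(** Intuitionistic variables get images typed in the empty linear context, so that they can be
    duplicated or erased. The field [ts_disj] serves [Unit] and [DZero], whose rules absorb
    arbitrary linear variables. *)
Record typed_subst (S : Type) (T : judgement S) (o : nat -> nat)
    (s : nat -> term S) Y G Y' G' : Prop := TypedSubst {
  ts_disj : disj Y' G';
  ts_own : forall k, G'.[? k] -> G.[? o k];
  ts_lin : forall x A, G.[? x] = Some A ->
    T Y' (filterf G' (fun k => o k == x)) (s x) A;
  ts_int : forall x A, Y.[? x] = Some A -> T Y' [fmap] (s x) A
}.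

(** The target context is cut according to whether the owner of each variable lies in [G] or in [D];
    the substitution and the ownership map stay the same on both sides. *)
Lemma typed_subst_split S (T : judgement S) o s Y G D Y' H :
  disj G D -> typed_subst T o s Y (G + D) Y' H ->
  exists G' D', [/\ H = G' + D', disj G' D',
    typed_subst T o s Y G Y' G' & typed_subst T o s Y D Y' D'].
Proof.
move=> /disjP dGD [/disjP dYH own lin int].
(* Both halves at once: for [x] in [E], keeping the variables with owner in [E] and then those owned
   by [x] amounts to keeping those owned by [x]. *)
have sub (E : context) : (forall x A, E.[? x] = Some A -> (G + D).[? x] = Some A) ->
    typed_subst T o s Y E Y' (filterf H (fun k => E.[? o k])).
  move=> sE; split=> //.
  - apply/disjP => k Yk; rewrite fnd_filterf; case: ifP => // _; exact: dYH.
  - by move=> k; rewrite fnd_filterf; case: ifP.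
  - move=> x A Ex; have := lin _ _ (sE _ _ Ex); congr T; apply/fmapP => k.
    by rewrite !fnd_filterf; case: eqP => // ->; rewrite Ex.
exists (filterf H (fun k => G.[? o k])), (filterf H (fun k => D.[? o k])).
split.
- apply/fmapP => k; rewrite fnd_catE !fnd_filterf.
  case Hk: H.[? k] => [A|]; last by rewrite !if_same.
  by have := own k; rewrite Hk fnd_catE => /(_ isT); case: D.[? o k] => //= ->.
- apply/disjP => k; rewrite !fnd_filterf.
  by case: ifP => // Gk _; case: ifP => // Dk _; apply: (dGD (o k)).
- apply: sub => x A Gx; rewrite fnd_catE; case Dx: D.[? x] => [B|//].
  by case: (dGD x); rewrite ?Gx ?Dx.
- by apply: sub => x A Dx; rewrite fnd_catE Dx.
Qed.

Lemma typed_subst0 S (T : judgement S) o s Y Y' H :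
  typed_subst T o s Y [fmap] Y' H -> H = [fmap].
Proof.
case=> _ own _ _; apply/fmapP => k; rewrite fnd_fmap0.
by case Hk: H.[? k] => [A|//]; have := own k; rewrite Hk fnd_fmap0 => /(_ isT).
Qed.

(** What typed images must satisfy for substitutions to cross binders; the
    instances are typing restricted to variables, then full typing. *)
Record substitutive (S : Type) (T : judgement S) : Prop := Substitutive {
  sb_lvar : forall Y n A, n \notin domf Y -> T Y [fmap].[n <- A] (Var n) A;
  sb_ivar : forall Y n A, Y.[? n] = Some A -> T Y [fmap] (Var n) A;
  sb_shift : forall Y G t A,
    T Y G t A -> T (shift Y) (shift G) (rename succn t) A;
  sb_ext : forall Y G t A B,
    T Y G t A -> T (ext Y B) (shift G) (rename succn t) A;
  sb_typing : forall Y G t A, T Y G t A -> typing Y G t A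
}.

Lemma shift0 : shift [fmap] = [fmap].
Proof. by apply/fmapP => -[|k]; rewrite fnd_shift !fnd_fmap0. Qed.

Lemma shift_filterf G P Q : (forall k, P k.+1 = Q k) ->
  filterf (shift G) P = shift (filterf G Q).
Proof.
move=> PQ; apply/fmapP => -[|k]; rewrite fnd_filterf !fnd_shift ?if_same //.
by rewrite fnd_filterf PQ.
Qed.

(** The new variable 0 owns itself, and [upren o] transports the ownership of the older
    variables. *)
Lemma typed_subst_lin S (T : judgement S) o s Y G Y' G' A :
  substitutive T -> typed_subst T o s Y G Y' G' ->
  typed_subst T (upren o) (up s) (shift Y) (ext G A) (shift Y') (ext G' A).
Proof.
move=> sT [dYG own lin int]; split; first by rewrite disj_shift_ext.
- by move=> [|k]; rewrite !fnd_ext //; apply: own.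
- move=> [|x] B; rewrite fnd_ext; [move=> [<-] | move=> Gx] => /=.
    have -> : filterf (ext G' A) (fun k => upren o k == 0) = [fmap].[0 <- A].
      by apply/fmapP => -[|k]; rewrite fnd_filterf fnd_ext fnd_set ?fnd_fmap0.
    by apply: (sb_lvar sT); rewrite mem_domf fnd_shift.
  have := sb_shift sT (lin _ _ Gx); congr T; apply/fmapP => -[|k].
    by rewrite fnd_shift fnd_filterf.
  by rewrite fnd_shift !fnd_filterf fnd_ext.
- move=> [|x] B; rewrite fnd_shift // => Yx.
  by have := sb_shift sT (int _ _ Yx); rewrite shift0.
Qed.

Lemma typed_subst_int S (T : judgement S) o s Y G Y' G' A :
  substitutive T -> typed_subst T o s Y G Y' G' ->
  typed_subst T (upren o) (up s) (ext Y A) (shift G) (ext Y' A) (shift G').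
Proof.
move=> sT [dYG own lin int]; split; first by rewrite disj_ext_shift.
- by move=> [|k]; rewrite !fnd_shift //; apply: own.
- move=> [|x] B; rewrite fnd_shift //= => Gx.
  rewrite (@shift_filterf _ _ (fun k => o k == x)) //.
  exact: (sb_ext sT _ (lin _ _ Gx)).
- move=> [|x] B; rewrite fnd_ext; [move=> [<-] | move=> Yx] => /=.
    by apply: (sb_ivar sT); rewrite fnd_ext.
  by have := sb_ext sT A (int _ _ Yx); rewrite shift0.
Qed.

(** Induction on the typing derivation, with the substitution and its target contexts generalized so
    that they can change under binders and at splits. *)
Lemma subst_typing S (T : judgement S) Y G (t : term S) A :
  substitutive T -> typing Y G t A ->
  forall o s Y' G', typed_subst T o s Y G Y' G' -> typing Y' G' (subst s t) A.
Proof.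
move=> sT; elim=> {Y G t A} /=.
- move=> Y n A _ o s Y' G' [_ own lin _]; apply: (sb_typing sT).
  (* The source context is the singleton [n], so [n] owns all of [G'] and the filter is the
     identity. *)
  have := lin n A; rewrite fnd_set eqxx => /(_ erefl); congr T.
  apply/fmapP => k; rewrite fnd_filterf.
  case Gk: G'.[? k] => [B|]; last by rewrite if_same.
  by have := own k; rewrite Gk fnd_set fnd_fmap0; case: eqP => // _ /(_ isT).
- move=> Y n A Yn o s Y' G' ts; rewrite (typed_subst0 ts).
  exact: (sb_typing sT (ts_int ts Yn)).
- by move=> Y G t u A _ IHt _ IHu o s Y' G' ts; apply: ty_sum; eauto.
- by move=> Y G a t A _ IHt o s Y' G' ts; apply: ty_scal; eauto.
- move=> Y a o s Y' G' ts; rewrite (typed_subst0 ts); exact: ty_star.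
- move=> Y G D t u A dGD _ IHt _ IHu o s Y' H.
  case/(typed_subst_split dGD) => G' [D'] [-> dGD' tG tD].
  by apply: ty_done; eauto.
- move=> Y G t A B _ IHt o s Y' G' ts; apply: ty_lam.
  exact: IHt (typed_subst_lin _ sT ts).
- move=> Y G D t u A B dGD _ IHt _ IHu o s Y' H.
  case/(typed_subst_split dGD) => G' [D'] [-> dGD' tG tD].
  by apply: ty_app; eauto.
- move=> Y G D t u A B dGD _ IHt _ IHu o s Y' H.
  case/(typed_subst_split dGD) => G' [D'] [-> dGD' tG tD].
  by apply: ty_tensor; eauto.
- move=> Y G D t u A B C dGD _ IHt _ IHu o s Y' H.
  case/(typed_subst_split dGD) => G' [D'] [-> dGD' tG tD].
  apply: (ty_dtensor dGD' (IHt _ _ _ _ tG)).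
  exact: IHu (typed_subst_lin _ sT (typed_subst_lin _ sT tD)).
- by move=> Y G _ o s Y' G' /ts_disj; apply: ty_unit.
- move=> Y G D t C dGD _ _ IHt o s Y' H.
  case/(typed_subst_split dGD) => G' [D'] [-> dGD' tG tD].
  exact: (ty_dzero _ dGD' (ts_disj tD) (IHt _ _ _ _ tG)).
- by move=> Y G t u A B _ IHt _ IHu o s Y' G' ts; apply: ty_pair; eauto.
- move=> Y G D t u A B C dGD _ IHt _ IHu o s Y' H.
  case/(typed_subst_split dGD) => G' [D'] [-> dGD' tG tD].
  apply: (ty_dwith1 dGD' (IHt _ _ _ _ tG)).
  exact: IHu (typed_subst_lin _ sT tD).
- move=> Y G D t u A B C dGD _ IHt _ IHu o s Y' H.
  case/(typed_subst_split dGD) => G' [D'] [-> dGD' tG tD].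
  apply: (ty_dwith2 dGD' (IHt _ _ _ _ tG)).
  exact: IHu (typed_subst_lin _ sT tD).
- by move=> Y G t A B _ IHt o s Y' G' ts; apply: ty_inl; eauto.
- by move=> Y G t A B _ IHt o s Y' G' ts; apply: ty_inr; eauto.
- move=> Y G D t u v A B C dGD _ IHt _ IHu _ IHv o s Y' H.
  case/(typed_subst_split dGD) => G' [D'] [-> dGD' tG tD].
  apply: (ty_dplus dGD' (IHt _ _ _ _ tG)).
    exact: IHu (typed_subst_lin _ sT tD).
  exact: IHv (typed_subst_lin _ sT tD).
(* An empty source context leaves no possible owner, so the target is empty too and promotion
   applies again. *)
- move=> Y t A _ IHt o s Y' G' ts; have G'0 := typed_subst0 ts.
  by rewrite G'0 in ts *; apply: ty_bang; apply: IHt ts.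
- move=> Y G D t u A B dGD _ IHt _ IHu o s Y' H.
  case/(typed_subst_split dGD) => G' [D'] [-> dGD' tG tD].
  apply: (ty_dbang dGD' (IHt _ _ _ _ tG)).
  exact: IHu (typed_subst_int _ sT tD).
Qed.

(** * Weakening *)

Lemma up_ext S (s s' : nat -> term S) : s =1 s' -> up s =1 up s'.
Proof. by move=> ss' [|n] //=; rewrite ss'. Qed.

Lemma subst_ext S (t : term S) s s' : s =1 s' -> subst s t = subst s' t.
Proof.
by elim: t s s' => //=; intros; f_equal; eauto using up_ext.
Qed.

Lemma rename_subst S (t : term S) r : rename r t = subst (Var \o r) t.
Proof.
elim: t r => //=; intros; f_equal; eauto;
  match goal with H : forall r, _ |- _ = subst _ ?u => rewrite H; apply: subst_ext end;
  (* [DTensor] crosses two binders, hence the separate cases of indices 0 and 1. *)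
  by case=> [|[]].
Qed.

(** For variables, closure under shifting follows by inversion, without weakening. This avoids a
    circularity, since crossing binders with arbitrary images requires weakening. *)
Definition var_typing (S : Type) : judgement S :=
  fun Y G t A => typing Y G t A /\ exists n, t = Var n.

Lemma var_typingP S Y G n A : typing Y G (Var n : term S) A ->
  n \notin domf Y /\ G = [fmap].[n <- A] \/ G = [fmap] /\ Y.[? n] = Some A.
Proof. by move=> tn; inversion tn; subst; [left | right]. Qed.

Lemma shift_set1 n A : shift [fmap].[n <- A] = [fmap].[n.+1 <- A].
Proof. by apply/fmapP => -[|k]; rewrite fnd_shift !fnd_set !fnd_fmap0. Qed.

Lemma var_typing_substitutive S : substitutive (@var_typing S).
Proof.
split=> [Y n A nY|Y n A Yn|Y G t A [tt [n En]]|Y G t A B [tt [n En]]|Y G t A [//]].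
- by split; [apply: ty_lvar | exists n].
- by split; [apply: ty_ivar | exists n].
- subst t; split; last by exists n.+1.
  case: (var_typingP tt) => [[nY ->]|[-> Yn]].
    rewrite shift_set1; apply: ty_lvar.
    by rewrite mem_domf fnd_shift -mem_domf.
  by rewrite shift0; apply: ty_ivar; rewrite fnd_shift.
- subst t; split; last by exists n.+1.
  case: (var_typingP tt) => [[nY ->]|[-> Yn]].
    rewrite shift_set1; apply: ty_lvar.
    by rewrite mem_domf fnd_ext -mem_domf.
  by rewrite shift0; apply: ty_ivar; rewrite fnd_ext.
Qed.

(** Leaving [Y'] general covers both ways of entering a binder, [shift Y] and [ext Y B]. *)
Lemma typing_weaken S Y Y' G (t : term S) A :
  disj Y' (shift G) -> (forall n, Y.[? n] -> Y'.[? n.+1] = Y.[? n]) ->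
  typing Y G t A -> typing Y' (shift G) (rename succn t) A.
Proof.
move=> dYG YY' tt; rewrite rename_subst.
(* The variable [k.+1] is owned by [k]. Although [predn] also sends 0 to 0, index 0 is not declared
   in [shift G]. *)
apply: (subst_typing (@var_typing_substitutive S) tt (o := predn)); split=> //.
- by move=> [|k]; rewrite fnd_shift.
- move=> x B Gx; split; last by exists x.+1.
  have -> : filterf (shift G) (fun k => k.-1 == x) = [fmap].[x.+1 <- B].
    apply/fmapP => -[|k]; rewrite fnd_filterf fnd_shift fnd_set fnd_fmap0 ?if_same //=.
    by rewrite eqSS; case: eqP => // ->.
  apply: ty_lvar; apply/negP; rewrite mem_domf => Yx.
  by apply: (disjP _ _ dYG _ Yx); rewrite fnd_shift Gx.
- move=> x B Yx; split; last by exists x.+1.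
  by apply: ty_ivar; rewrite YY' Yx.
Qed.

Lemma typing_substitutive S : substitutive (@typing S).
Proof.
split=> //; [exact: ty_lvar | exact: ty_ivar | |].
- move=> Y G t A tt; apply: (typing_weaken _ _ tt).
    by rewrite disj_shift (typing_disj tt).
  by move=> n _; rewrite fnd_shift.
- move=> Y G t A B tt; apply: (typing_weaken _ _ tt).
    by rewrite disj_ext_shift (typing_disj tt).
  by move=> n _; rewrite fnd_ext.
Qed.

(** * Substitution *)

(** By conversion, [subst1 u] is substitution by [scons u Var], and [subst2 u v] by
    [scons v (scons u Var)]. *)
Definition scons S (u : term S) (s : nat -> term S) (n : nat) : term S :=
  if n is m.+1 then s m else u.

(** The variables of [G], consumed by [u], are owned by the new index 0; those of [D'] keep their
    owner, raised by one. *)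
Lemma typed_subst_scons S (T : judgement S) o s Y D Y' G D' u A :
  disj G D' -> disj Y' G -> T Y' G u A -> typed_subst T o s Y D Y' D' ->
  typed_subst T (fun k => if G.[? k] then 0 else (o k).+1) (scons u s)
    (shift Y) (ext D A) Y' (G + D').
Proof.
move=> /disjP dGD dYG tu [dYD own lin int]; split.
- exact: disj_catr.
- move=> k; rewrite fnd_catE fnd_ext; case: ifP => // Gk.
  by case Dk: D'.[? k] => [B|]; [move=> _; apply: own; rewrite Dk | rewrite Gk].
- move=> [|x] B; rewrite fnd_ext; [move=> [<-] | move=> Dx] => /=.
    (* Lookup in [G + D'] gives priority to [D'], whereas ownership tests [G] first; disjointness
       reconciles the two. *)
    congr T: tu; apply/fmapP => k; rewrite fnd_filterf fnd_catE.
    case Gk: G.[? k] => [E|] //=.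
    by case Dk: D'.[? k] => [F|//]; case: (dGD k); rewrite ?Gk ?Dk.
  have := lin _ _ Dx; congr T; apply/fmapP => k; rewrite !fnd_filterf fnd_catE.
  case Gk: G.[? k] => [E|] /=; last by rewrite eqSS; case: D'.[? k].
  by case Dk: D'.[? k] => [F|]; rewrite ?if_same //; case: (dGD k); rewrite ?Gk ?Dk.
- by move=> [|x] B; rewrite fnd_shift //; apply: int.
Qed.

Lemma typed_subst_scons_int S (T : judgement S) o s Y D Y' D' u A :
  T Y' [fmap] u A -> typed_subst T o s Y D Y' D' ->
  typed_subst T (fun k => (o k).+1) (scons u s) (ext Y A) (shift D) Y' D'.
Proof.
move=> tu [dYD own lin int]; split=> //.
- by move=> k; rewrite fnd_shift; apply: own.
- by move=> [|x] B; rewrite fnd_shift //; apply: lin.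
- by move=> [|x] B; rewrite fnd_ext; [move=> [<-] | apply: int].
Qed.

(** The identity substitution, where each linear variable owns itself, is the base on which [scons]
    builds. *)
Lemma typed_subst_Var S Y D :
  disj Y D -> typed_subst (@typing S) id Var Y D Y D.
Proof.
move=> dYD; split=> // x A; last exact: ty_ivar.
move=> Dx; have -> : filterf D (fun k => id k == x) = [fmap].[x <- A].
  apply/fmapP => k; rewrite fnd_filterf fnd_set fnd_fmap0 /=.
  by case: eqP => // ->.
apply: ty_lvar; apply/negP; rewrite mem_domf => Yx.
by apply: (disjP _ _ dYD _ Yx); rewrite Dx.
Qed.

Lemma typing_subst1 S Y G D (t u : term S) A B :
  disj G D -> typing Y G u A -> typing (shift Y) (ext D A) t B ->
  typing Y (G + D) (subst1 u t) B.
Proof.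
move=> dGD tu tt; have := typing_disj tt; rewrite disj_shift_ext => dYD.
apply: (subst_typing (@typing_substitutive S) tt).
exact: (typed_subst_scons dGD (typing_disj tu) tu (typed_subst_Var _ dYD)).
Qed.

Lemma typing_subst2 S Y G1 G2 D (u v w : term S) A B C :
  disj G1 G2 -> disj (G1 + G2) D -> typing Y G1 u A -> typing Y G2 v B ->
  typing (shift (shift Y)) (ext (ext D A) B) w C ->
  typing Y (G1 + G2 + D) (subst2 u v w) C.
Proof.
(* The context is rearranged as [G2 + (G1 + D)] to match the nesting of [scons]: [v] replaces index
   0 and is added last. *)
move=> dG; rewrite (disjoint_catfC dG) -catfA /disj fdisjoint_sym.
case/disj_catrP => dG2 dG1 tu tv tw.
have := typing_disj tw; rewrite !disj_shift_ext => dYD.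
have d1 : disj G1 D by rewrite /disj fdisjoint_sym.
have d2 : disj G2 (G1 + D) by apply: disj_catr; rewrite /disj fdisjoint_sym.
apply: (subst_typing (@typing_substitutive S) tw).
apply: (typed_subst_scons d2 (typing_disj tv) tv).
exact: (typed_subst_scons d1 (typing_disj tu) tu (typed_subst_Var _ dYD)).
Qed.

Lemma typing_subst_int S Y D (t u : term S) A B :
  typing Y [fmap] u A -> typing (ext Y A) (shift D) t B ->
  typing Y D (subst1 u t) B.
Proof.
move=> tu tt; have := typing_disj tt; rewrite disj_ext_shift => dYD.
apply: (subst_typing (@typing_substitutive S) tt).
exact: (typed_subst_scons_int tu (typed_subst_Var _ dYD)).
Qed.

(** * Inversion of typing derivations and subject reduction *)

Ltac invert_typing :=
  match goal with
  | H : typing _ _ ?t _ |- _ =>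
      tryif is_var t then fail else (inversion H; subst; clear H)
  end.

Theorem theorem2p1 (S : comPzSemiRingType) (Y G : context) (t u : term S)
    (A : formula) :
  typing Y G t A -> red t u -> typing Y G u A.
Proof.
move=> tt tu; elim: tu Y G A tt => {t u}; intros; invert_typing.
(* The congruence rules need a single inversion and the induction hypothesis; the other rules need
   the typing of the inner constructors as well. *)
all: try by econstructor; eauto.
all: repeat invert_typing.
all: try by repeat (econstructor; eauto).
all: try by apply: typing_subst1; eauto.
(* [Star a] is typed in the empty linear context, so all resources belong to the continuation. *)
- by rewrite cat0f; apply: ty_scal.
(* In [App] the context of the argument comes second, whereas [typing_subst1] expects it first. *)
- by rewrite disjoint_catfC //; apply: typing_subst1; eauto;
    rewrite /disj fdisjoint_sym.
- by apply: typing_subst2; eauto.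
(* Promotion forces the linear context of the substituted term to be empty, as intuitionistic
   substitution requires. *)
- by rewrite cat0f; apply: typing_subst_int; eauto.
Qed.
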